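(* Let $E$ be a finite-dimensional $\mathbb K$-vector space with subspaces $V_1,V_2,W_1,W_2$ such that $E=V_1\oplus V_2=W_1\oplus W_2$. For every element $V$ of the lattice of subspaces generated by $V_1,V_2,W_1,W_2$ under sum and intersection, one has $$V=(V\cap F_e)\oplus(V\cap F_\tau)\oplus(V\cap\tilde F).$$
   Context: $\mathbb K$ is a commutative field of characteristic different from $2$. Write $e$ for the identity and $\tau=(1\,2)$ for the transposition in the group $\mathcal S_2$ of permutations of $\{1,2\}$. For $\sigma\in\mathcal S_2$ set $F_\sigma(0)=\{0\}$, $F_\sigma(n+1)=\sum_{i=1}^{2}\big((F_\sigma(n)+V_i)\cap(F_\sigma(n)+W_{\sigma(i)})\big)$ (an increasing sequence), and $F_\sigma=\sum_n F_\sigma(n)$. Set $\tilde F(0)=E$, $\tilde F(n+1)=\bigcap_{i,j\in\{1,2\}}\big((\tilde F(n)\cap V_i)+(\tilde F(n)\cap W_j)\big)$ (a decreasing sequence), and $\tilde F=\bigcap_n\tilde F(n)$. *)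

(* Defs.v *)
From mathcomp Require Import all_boot all_order all_algebra all_fingroup.
From mathcomp Require Import boolp classical_sets.

Set Implicit Arguments.
Unset Strict Implicit.
Unset Printing Implicit Defensive.

Import GRing.Theory.
Local Open Scope ring_scope.

Section SeqSubspaces.
Variables (K : fieldType) (E : vectType K).
Implicit Type U : nat -> {vspace E}.

Lemma seqsumv_exists U : exists S : {vspace E},
  forall v, v \in S <-> exists N, v \in (\sum_(n < N) U n)%VS.
Proof.
pose P d := `[< exists N, \dim (\sum_(n < N) U n)%VS = d >].
have exP : exists d, P d by exists (\dim (\sum_(n < 0) U n)%VS); apply/asboolP; exists 0%N.
have ubP d : P d -> (d <= \dim {: E})%N.
  by move=> /asboolP[N <-]; apply/dimvS/subvf.
case: (ex_maxnP exP ubP) => d /asboolP[N dN] maxd.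
exists (\sum_(n < N) U n)%VS => v; split=> [vN|[M vM]]; first by exists N.
have mono A B : (A <= B)%N -> (\sum_(n < A) U n <= \sum_(n < B) U n)%VS.
  move=> leAB; apply/subv_sumP => i _.
  exact: (sumv_sup (widen_ord leAB i)).
have /eqP -> : (\sum_(n < N) U n == \sum_(n < maxn M N) U n)%VS.
  rewrite eqEdim mono ?leq_maxr //= dN.
  by apply: maxd; apply/asboolP; exists (maxn M N).
by apply: subvP vM; rewrite mono ?leq_maxl.
Qed.

Lemma seqcapv_exists U : exists S : {vspace E},
  forall v, v \in S <-> forall n, v \in U n.
Proof.
pose P d := `[< exists N, \dim (\bigcap_(n < N) U n)%VS = d >].
have exP : exists d, P d by exists (\dim (\bigcap_(n < 0) U n)%VS); apply/asboolP; exists 0%N.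
case: (ex_minnP exP) => d /asboolP[N dN] mind.
exists (\bigcap_(n < N) U n)%VS => v; split=> [vN n|vU]; last first.
  by rewrite memvE; apply/subv_bigcapP => i _; rewrite -memvE.
have mono A B : (A <= B)%N -> (\bigcap_(n < B) U n <= \bigcap_(n < A) U n)%VS.
  move=> leAB; apply/subv_bigcapP => i _.
  exact: (bigcapv_inf (widen_ord leAB i)).
have /eqP eqN : (\bigcap_(n < maxn n.+1 N) U n == \bigcap_(n < N) U n)%VS.
  rewrite eqEdim mono ?leq_maxr //= dN.
  by apply: mind; apply/asboolP; exists (maxn n.+1 N).
have ltn_max : (n < maxn n.+1 N)%N by rewrite leq_maxl.
rewrite -eqN in vN; apply: subvP vN.
exact: (bigcapv_inf (Ordinal ltn_max)).
Qed.

(* The sum of an arbitrary sequence of subspaces: the vectors that are finite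
   sums of vectors taken from the [U n]. *)
Definition seqsumv U : {vspace E} := sval (cid (seqsumv_exists U)).

Definition seqcapv U : {vspace E} := sval (cid (seqcapv_exists U)).

Lemma memv_seqsumv U v :
  v \in seqsumv U <-> exists N, v \in (\sum_(n < N) U n)%VS.
Proof. exact: (svalP (cid (seqsumv_exists U))). Qed.

Lemma memv_seqcapv U v : v \in seqcapv U <-> forall n, v \in U n.
Proof. exact: (svalP (cid (seqcapv_exists U))). Qed.

Inductive lattice_generated (S : set {vspace E}) : {vspace E} -> Prop :=
| lattice_generated_gen X : S X -> lattice_generated S X
| lattice_generated_add X Y : lattice_generated S X -> lattice_generated S Y ->
    lattice_generated S (X + Y)%VS
| lattice_generated_cap X Y : lattice_generated S X -> lattice_generated S Y ->
    lattice_generated S (X :&: Y)%VS.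

End SeqSubspaces.

Section TwoDecompositions.
Variables (K : fieldType) (E : vectType K) (V W : 'I_2 -> {vspace E}).

Fixpoint F_seq (s : 'S_2) (n : nat) : {vspace E} :=
  if n is m.+1 then
    (\sum_(i < 2) ((F_seq s m + V i) :&: (F_seq s m + W (s i))))%VS
  else 0%VS.

Definition F_ (s : 'S_2) : {vspace E} := seqsumv (F_seq s).

Fixpoint Ftilde_seq (n : nat) : {vspace E} :=
  if n is m.+1 then
    (\bigcap_(i < 2) \bigcap_(j < 2)
       ((Ftilde_seq m :&: V i) + (Ftilde_seq m :&: W j)))%VS
  else fullv.

Definition Ftilde : {vspace E} := seqcapv Ftilde_seq.

End TwoDecompositions.

(* The transposition (1 2); the indices 1, 2 are encoded as 0, 1 : 'I_2. *)
Definition tau : 'S_2 := tperm ord0 ord_max.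

(* Main.v *)
Require Import Defs.
From mathcomp Require Import all_boot all_order all_algebra all_fingroup.
From mathcomp Require Import boolp classical_sets.

(** Let [p] and [q] be the projections onto [V_1] along [V_2] and onto [W_1]
    along [W_2], and put [a = p - q] and [b = p - (1 - q)]; replacing [W] by
    its swap exchanges [a] and [b]. From [a p = (1 - q) a] and
    [a q = (1 - p) a] (and the same for [b]) it follows that images and
    preimages under [a] and [b] of subspaces stable under [p] and [q] are again
    stable under [p] and [q].

    For a subspace [X] stable under [p] and [q], elementary computations
    ([lpreim_diff], [limg_diff]) identify the steps of the three sequences.
    One step of the [F_e] sequence sends [X] to the preimage of [X] under [a],
    so that [F_e] is the set of vectors killed by some power of [a]; likewise
    [F_tau] is the set of vectors killed by some power of [b]. One step of the
    [Ftilde] sequence sends [X] to the intersection of [a X] and [b X], so that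
    [Ftilde] is the largest such subspace mapped onto itself by [a] and by [b].

    If [a v = 0] then [b (b v) = v], because [a^2 + b^2 = 1]; hence [a] is
    injective on [F_tau]. As [a] and [b] are bijective on [Ftilde], the three
    subspaces are independent. They span [E]: Fitting's lemma for [a] splits
    off [F_e] from [E], and Fitting's lemma for [b] on the remaining summand
    splits off a part of [F_tau]; what is left is mapped onto itself by both
    [a] and [b], hence lies in [Ftilde].

    The three summands are stable under [p] and [q], so every kernel of [p],
    [q], [1 - p] or [1 - q], that is, every [V_i] and [W_j], contains the
    components of each of its vectors. Sums and intersections inherit this
    property, which therefore holds on the whole lattice. *)

Import GRing.Theory.
Local Open Scope ring_scope.
Local Open Scope classical_set_scope.

(** * Fitting's lemma *)

Section Fitting.
Set Implicit Arguments.
Unset Strict Implicit.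
Variables (K : fieldType) (E : vectType K).
Implicit Types (U I : {vspace E}) (f : 'End(E)).

(** The dimension can drop only finitely often, and once two consecutive terms
    agree the recursion keeps the sequence constant. *)
Lemma stationary_iter (G : {vspace E} -> {vspace E}) (U : nat -> {vspace E}) :
    (forall n, U n.+1 = G (U n)) -> (forall n, U n.+1 <= U n)%VS ->
  exists2 N, G (U N) = U N & forall n, (U N <= U n)%VS.
Proof.
move=> UG Udec.
pose P d := `[< exists N, \dim (U N) = d >].
have exP : exists d, P d by exists (\dim (U 0%N)); apply/asboolP; exists 0%N.
case: (ex_minnP exP) => d /asboolP[N dN] mind.
have GN : G (U N) = U N.
  rewrite -UG; apply/eqP; rewrite eqEdim Udec dN.
  by apply: mind; apply/asboolP; exists N.+1.
have mono m k : (U (m + k)%N <= U m)%VS.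
  by elim: k => [|k IHk]; rewrite ?addn0 // addnS; apply: subv_trans IHk.
have const k : U (N + k)%N = U N.
  by elim: k => [|k IHk]; rewrite ?addn0 // addnS UG IHk.
by exists N => // n; rewrite -(const n) addnC.
Qed.

Lemma iter_lfun0 f n : iter n f 0 = 0.
Proof. by elim: n => //= n ->; rewrite linear0. Qed.

Lemma iter_lfunD f n u v : iter n f (u + v) = iter n f u + iter n f v.
Proof. by elim: n => //= n ->; rewrite linearD. Qed.

Lemma iter_lfunB f n u v : iter n f (u - v) = iter n f u - iter n f v.
Proof. by elim: n => //= n ->; rewrite linearB. Qed.

Lemma iter_lfun_eq0 f m n v : (m <= n)%N -> iter m f v = 0 -> iter n f v = 0.
Proof. by move=> /subnK <- fv0; rewrite iterD fv0 iter_lfun0. Qed.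

Lemma limg_id_inj {f U} : (f @: U)%VS = U ->
  forall u, u \in U -> f u = 0 -> u = 0.
Proof.
move=> fU u Uu fu0; apply/eqP; rewrite -memv0.
have /eqP <- : (U :&: lker f == 0)%VS.
  by rewrite -dimv_eq0 -(eqn_add2r (\dim (f @: U))) limg_ker_dim fU.
by rewrite memv_cap Uu memv_ker fu0 eqxx.
Qed.

Lemma inj_limg_id f U : (f @: U <= U)%VS ->
  (forall u, u \in U -> f u = 0 -> u = 0) -> (f @: U)%VS = U.
Proof.
move=> fU finj; suff capK : (U :&: lker f)%VS = 0%VS.
  by apply/eqP; rewrite eqEdim fU (limg_dim_eq capK) /=.
apply/eqP; rewrite -subv0; apply/subvP => u /[!memv_cap] /andP[Uu].
by rewrite memv_ker memv0 => /eqP/(finj _ Uu)->.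
Qed.

Lemma iter_limg f U n v :
  v \in U -> iter n f v \in iter n (fun X => f @: X)%VS U.
Proof. by move=> Uv; elim: n => //= n; apply: memv_img. Qed.

Lemma iter_limgP f U n v : v \in iter n (fun X => f @: X)%VS U ->
  exists2 u, u \in U & v = iter n f u.
Proof.
elim: n v => [|n IHn] v /=; first by exists v.
by case/memv_imgP => _ /IHn[u Uu ->] ->; exists u.
Qed.

(** Once the images [f^N U] are stationary, [f^N v] is also the image under
    [f^N] of some [w] in [f^N U], and [v = (v - w) + w] is the Fitting
    decomposition of [v]. *)
Lemma fitting f U (I := fun n => iter n (fun X => f @: X)%VS U) :
    (f @: U <= U)%VS ->
  exists2 N, (f @: I N)%VS = I N &
    forall v, v \in U -> exists2 w, w \in I N & iter N f (v - w) = 0.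
Proof.
move=> fU.
have Idec n : (I n.+1 <= I n)%VS by elim: n => //= n; apply: limgS.
have [//|N fI minI] := @stationary_iter (fun X => f @: X)%VS I _ Idec.
exists N => // v Uv.
have /(subvP (minI (N + N)%N)) := iter_limg f N Uv.
rewrite /I iterD => /iter_limgP[w Iw fvw].
by exists w => //; rewrite iter_lfunB fvw subrr.
Qed.

End Fitting.

(** * The difference of two projections *)

Section TwoProjections.
Set Implicit Arguments.
Unset Strict Implicit.
Variables (K : fieldType) (E : vectType K).
Implicit Types (p q : 'End(E)) (V W : 'I_2 -> {vspace E}) (X : {vspace E}).

Lemma subr_lfunE p q v : (p - q) v = p v - q v.
Proof. by rewrite add_lfunE opp_lfunE. Qed.

(** [p] is the projection onto [V ord0] along [V ord_max]. The subspaces are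
    described by equations, so that all later arguments are computations with
    [p]. *)
Definition projects p V :=
  [/\ forall v, p (p v) = p v,
      forall v, (v \in V ord0) = (p v == v)
    & forall v, (v \in V ord_max) = (p v == 0)].

Definition reduces p q X :=
  forall v, v \in X -> p v \in X /\ q v \in X.

Lemma projects_daddv_pi V : (V ord0 + V ord_max)%VS = fullv ->
  directv (V ord0 + V ord_max) -> projects (daddv_pi (V ord0) (V ord_max)) V.
Proof.
move=> sumV /directv_addP capV.
have capV' : (V ord_max :&: V ord0)%VS = 0%VS by rewrite capvC.
have decomp v : daddv_pi (V ord0) (V ord_max) v
    + daddv_pi (V ord_max) (V ord0) v = v.
  by rewrite daddv_pi_add // sumV memvf.
split=> v; first exact: daddv_pi_proj.
  by apply/idP/eqP => [|<-]; [apply: daddv_pi_id | apply: memv_pi].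
apply/idP/eqP => [Vv|p0]; last first.
  by rewrite -(decomp v) p0 add0r; apply: memv_pi.
have := decomp v; rewrite (daddv_pi_id capV' Vv) => /(canRL (addrK _)).
by rewrite subrr.
Qed.

(** Swapping the two summands replaces the projection by its complement; this
    reduces every statement about [F_tau] to one about a difference of
    projections. *)
Lemma projects_compl q W : projects q W ->
  projects (\1%VF - q) (fun i => W (tau i)).
Proof.
case=> qq Wq0 Wq1.
have qE v : (\1%VF - q) v = v - q v by rewrite subr_lfunE id_lfunE.
split=> v; rewrite !qE ?tpermL ?tpermR.
- by rewrite linearB /= qq subrr subr0.
- by rewrite Wq1 -[RHS]subr_eq0 addrAC subrr sub0r oppr_eq0.
- by rewrite Wq0 subr_eq0 eq_sym.
Qed.

Lemma reduces_compl p q X : reduces p q X -> reduces p (\1%VF - q) X.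
Proof.
move=> redX v Xv; have [pX qX] := redX v Xv; split=> //.
by rewrite subr_lfunE id_lfunE rpredB.
Qed.

Section Difference.
Variables (p q : 'End(E)) (V W : 'I_2 -> {vspace E}).
Hypotheses (pV : projects p V) (qW : projects q W).
Let a : 'End(E) := p - q.

Let pp : forall v, p (p v) = p v. Proof. by case: pV. Qed.
Let qq : forall v, q (q v) = q v. Proof. by case: qW. Qed.
Let Vp0 : forall v, (v \in V ord0) = (p v == v). Proof. by case: pV. Qed.
Let Vp1 : forall v, (v \in V ord_max) = (p v == 0). Proof. by case: pV. Qed.
Let Wq0 : forall v, (v \in W ord0) = (q v == v). Proof. by case: qW. Qed.
Let Wq1 : forall v, (v \in W ord_max) = (q v == 0). Proof. by case: qW. Qed.

(** The twisted commutation rules [a p = (1 - q) a] and [a q = (1 - p) a] are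
    what makes images and preimages under [a] stable under [p] and [q]. *)
Lemma diff_p v : a (p v) = a v - q (a v).
Proof. by rewrite !subr_lfunE linearB /= pp qq opprB addrA subrK. Qed.

Lemma diff_q v : a (q v) = a v - p (a v).
Proof.
by rewrite !subr_lfunE linearB /= pp qq opprB [RHS]addrC addrA subrK.
Qed.

Lemma p_diff v : p (a v) = a (v - q v).
Proof. by rewrite linearB /= diff_q subKr. Qed.

Lemma q_diff v : q (a v) = a (v - p v).
Proof. by rewrite linearB /= diff_p subKr. Qed.

Lemma reduces_diff X v : reduces p q X -> v \in X -> a v \in X.
Proof. by move=> redX /redX[pX qX]; rewrite subr_lfunE rpredB. Qed.

Lemma reduces_limg X : reduces p q X -> reduces p q (a @: X).
Proof.
move=> redX _ /memv_imgP[u Xu ->]; have [pX qX] := redX u Xu.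
by rewrite p_diff q_diff; split; apply: memv_img; rewrite rpredB.
Qed.

Lemma reduces_lpreim X : reduces p q X -> reduces p q (a @^-1: X).
Proof.
move=> redX v; rewrite -!memv_preim => Xav; have [pX qX] := redX _ Xav.
by rewrite diff_p diff_q; split; rewrite rpredB.
Qed.

(** Modulo [X], a vector [v] lies in [V_1] and [W_1] when [p v = v = q v], and
    in [V_2] and [W_2] when [p v = 0 = q v]; in both cases [a v = 0].
    Conversely, if [a v = 0] modulo [X] then [p v = q v] lies in both [V_1] and
    [W_1], and [v - p v = v - q v] lies in both [V_2] and [W_2]. *)
Lemma lpreim_diff X : reduces p q X ->
  ((X + V ord0) :&: (X + W ord0) + (X + V ord_max) :&: (X + W ord_max)
    = a @^-1: X)%VS.
Proof.
move=> redX.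
have memX0 (r : 'End(E)) (U : {vspace E}) v : (forall v, r (r v) = r v) ->
    (forall v, (v \in U) = (r v == v)) -> (forall u, u \in X -> r u \in X) ->
    (v \in X + U)%VS -> v - r v \in X.
  move=> rr Ur Xr /memv_addP[x Xx [u + ->]]; rewrite Ur => /eqP ru.
  by rewrite linearD /= ru opprD addrACA subrr addr0 rpredB ?Xr.
have memX1 (r : 'End(E)) (U : {vspace E}) v :
    (forall v, (v \in U) = (r v == 0)) ->
    (forall u, u \in X -> r u \in X) -> (v \in X + U)%VS -> r v \in X.
  move=> Ur Xr /memv_addP[x Xx [u + ->]]; rewrite Ur => /eqP ru.
  by rewrite linearD /= ru addr0 Xr.
have Xp u : u \in X -> p u \in X by case/redX.
have Xq u : u \in X -> q u \in X by case/redX.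
apply/eqP; rewrite eqEsubv; apply/andP; split.
  rewrite subv_add; apply/andP; split; apply/subvP => v;
    rewrite memv_cap -memv_preim subr_lfunE => /andP[vV vW].
    have -> : p v - q v = (v - q v) - (v - p v).
      by rewrite opprB [RHS]addrC addrA subrK.
    by rewrite rpredB ?(memX0 q (W ord0)) ?(memX0 p (V ord0)).
  by rewrite rpredB ?(memX1 q (W ord_max)) ?(memX1 p (V ord_max)).
apply/subvP => v; rewrite -memv_preim => Xav.
have -> : v = p v + (v - p v) by rewrite addrC subrK.
apply: memv_add; rewrite memv_cap; apply/andP; split.
- by apply: (subvP (addvSr _ _)); rewrite Vp0 pp.
- have -> : p v = a v + q v by rewrite subr_lfunE subrK.
  by apply: memv_add; rewrite // Wq0 qq.
- by apply: (subvP (addvSr _ _)); rewrite Vp1 linearB /= pp subrr.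
- have -> : v - p v = - a v + (v - q v).
    by rewrite subr_lfunE opprB [RHS]addrC addrA subrK.
  by apply: memv_add; rewrite ?rpredN // Wq1 linearB /= qq subrr.
Qed.

(** The inclusion from right to left is read off from
    [a u = p u - q u = (u - q u) - (u - p u)]. For the other one, if
    [x + y = z + w] with the summands taken in [V_1], [W_1], [V_2], [W_2], then
    [u = x - z = w - y] has [p u = x] and [q u = - y], so [a u = x + y]. *)
Lemma limg_diff X : reduces p q X ->
  ((X :&: V ord0 + X :&: W ord0) :&: (X :&: V ord_max + X :&: W ord_max)
    = a @: X)%VS.
Proof.
move=> redX; apply/eqP; rewrite eqEsubv; apply/andP; split; apply/subvP => v.
  rewrite memv_cap => /andP[/memv_addP[x + [y + ->]]].
  rewrite !memv_cap Vp0 Wq0 => /andP[Xx /eqP px] /andP[Xy /eqP qy].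
  case/memv_addP => z + [w + xyzw].
  rewrite !memv_cap Vp1 Wq1 => /andP[Xz /eqP pz] /andP[Xw /eqP qw].
  have xz : x - z = w - y.
    by apply/eqP; rewrite subr_eq addrAC eq_sym subr_eq xyzw addrC.
  apply/memv_imgP; exists (x - z); first by rewrite rpredB.
  rewrite subr_lfunE {2}xz !linearB /= px pz qy qw.
  by rewrite !subr0 oppr0 sub0r opprK.
case/memv_imgP => u Xu ->; have [pX qX] := redX u Xu.
rewrite memv_cap subr_lfunE; apply/andP; split.
  by rewrite memv_add ?rpredN // memv_cap ?pX ?qX /= ?Vp0 ?Wq0 ?pp ?qq.
have -> : p u - q u = - (u - p u) + (u - q u).
  by rewrite opprB addrA subrK.
apply: memv_add; rewrite ?rpredN memv_cap rpredB //=.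
  by rewrite Vp1 linearB /= pp subrr.
by rewrite Wq1 linearB /= qq subrr.
Qed.

End Difference.

(** This is the identity [a^2 + b^2 = 1] on the kernel of [a], where
    [p v = q v] and therefore [b v = p v + p v - v]. *)
Lemma diff_compl_involutive p q v : (forall v, p (p v) = p v) ->
    (forall v, q (q v) = q v) ->
  (p - q) v = 0 -> (p - (\1%VF - q)) ((p - (\1%VF - q)) v) = v.
Proof.
move=> pp qq; rewrite subr_lfunE => /eqP; rewrite subr_eq0 => /eqP pq.
have bE u : (p - (\1%VF - q)) u = p u + q u - u.
  by rewrite !subr_lfunE id_lfunE opprB addrA.
have bv : (p - (\1%VF - q)) v = p v + p v - v by rewrite bE -pq.
have bpv : (p - (\1%VF - q)) (p v) = p v by rewrite bE pp pq qq addrK.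
by rewrite bv linearB linearD /= bpv bv subKr.
Qed.

End TwoProjections.

(** * The three components *)

Lemma big_ord2 (R : Type) (idx : R) (op : Monoid.law idx) (G : 'I_2 -> R) :
  \big[op/idx]_(i < 2) G i = op (G ord0) (G ord_max).
Proof.
by rewrite big_ord_recr big_ord1; congr (op (G _) (G _)); apply: val_inj.
Qed.

Lemma ord2P (P : 'I_2 -> Prop) : P ord0 -> P ord_max -> forall i, P i.
Proof.
move=> P0 P1 [[|[|//]] lti].
  by rewrite (_ : Ordinal lti = ord0) //; apply: val_inj.
by rewrite (_ : Ordinal lti = ord_max) //; apply: val_inj.
Qed.

Section Components.
Set Implicit Arguments.
Unset Strict Implicit.
Variables (K : fieldType) (E : vectType K).
Implicit Types (p q : 'End(E)) (V W : 'I_2 -> {vspace E}) (X : {vspace E}).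

Lemma F_seqE p q V W (s : 'S_2) :
    projects p V -> projects q (fun i => W (s i)) ->
  forall n, F_seq V W s n = iter n (fun X => (p - q) @^-1: X)%VS 0%VS
         /\ reduces p q (F_seq V W s n).
Proof.
move=> pV qW; elim=> [|n [IHn redn]].
  by split=> // v; rewrite !memv0 => /eqP->; rewrite !linear0 eqxx.
have FS : F_seq V W s n.+1 = ((p - q) @^-1: F_seq V W s n)%VS.
  by rewrite /= big_ord2; apply: (lpreim_diff pV qW redn).
by rewrite FS; split; [rewrite iterS -IHn | exact: (reduces_lpreim pV qW redn)].
Qed.

Lemma memv_F_seq p q V W (s : 'S_2) n v :
    projects p V -> projects q (fun i => W (s i)) ->
  (v \in F_seq V W s n) = (iter n (p - q) v == 0).
Proof.
move=> pV qW; have [-> _] := F_seqE pV qW n; elim: n v => [|n IHn] v.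
  by rewrite memv0.
by rewrite iterS -memv_preim IHn -iterSr.
Qed.

Lemma memv_F p q V W (s : 'S_2) v :
    projects p V -> projects q (fun i => W (s i)) ->
  v \in F_ V W s <-> exists n, iter n (p - q) v = 0.
Proof.
move=> pV qW; rewrite memv_seqsumv; split=> [[N vN]|[n pqv]].
  exists N; apply/eqP; rewrite -(memv_F_seq _ _ pV qW).
  apply: subvP vN; apply/subv_sumP => i _; apply/subvP => u.
  rewrite !(memv_F_seq _ _ pV qW) => /eqP pqu; apply/eqP.
  exact: iter_lfun_eq0 (ltnW (ltn_ord i)) pqu.
exists n.+1; move/eqP: pqv; rewrite -(memv_F_seq _ _ pV qW).
exact/subvP/(sumv_sup ord_max).
Qed.

Lemma reduces_F p q V W (s : 'S_2) :
    projects p V -> projects q (fun i => W (s i)) ->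
  reduces p q (F_ V W s).
Proof.
move=> pV qW v /(memv_F _ pV qW)[n /eqP]; rewrite -(memv_F_seq _ _ pV qW).
have [_ redn] := F_seqE pV qW n => /redn[].
by rewrite !(memv_F_seq _ _ pV qW) => /eqP pv /eqP qv;
  split; apply/(memv_F _ pV qW); exists n.
Qed.

Section Ftilde.
Variables (p q : 'End(E)) (V W : 'I_2 -> {vspace E}).
Hypotheses (pV : projects p V) (qW : projects q W).
Let a : 'End(E) := p - q.
Let b : 'End(E) := p - (\1%VF - q).

Lemma reduces_limg_compl X : reduces p q X -> reduces p q (b @: X).
Proof.
move/reduces_compl => redX.
have /reduces_compl := reduces_limg pV (projects_compl qW) redX.
by rewrite subKr.
Qed.

Lemma Ftilde_seqS n : reduces p q (Ftilde_seq V W n) ->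
  (Ftilde_seq V W n.+1 =
    (a @: Ftilde_seq V W n) :&: (b @: Ftilde_seq V W n))%VS.
Proof.
move=> redn; rewrite /= !big_ord2 /= -(limg_diff pV qW redn).
rewrite -(limg_diff pV (projects_compl qW) (reduces_compl redn)) /=.
rewrite tpermL tpermR.
by rewrite -!capvA; congr (_ :&: _)%VS; rewrite capvA capvC.
Qed.

Lemma reduces_Ftilde_seq n : reduces p q (Ftilde_seq V W n).
Proof.
elim: n => [|n IHn] v; first by rewrite !memvf.
rewrite (Ftilde_seqS IHn) !memv_cap => /andP[av bv].
have [pav qav] := reduces_limg pV qW IHn av.
by have [pbv qbv] := reduces_limg_compl IHn bv; rewrite pav qav pbv qbv.
Qed.

Lemma limg_Ftilde :
  (a @: Ftilde V W = Ftilde V W /\ b @: Ftilde V W = Ftilde V W)%VS.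
Proof.
pose F := Ftilde_seq V W.
have FS n : F n.+1 = ((a @: F n) :&: (b @: F n))%VS.
  exact: (Ftilde_seqS (@reduces_Ftilde_seq n)).
have aF n : (a @: F n <= F n)%VS.
  apply/subvP => _ /memv_imgP[u Fu ->].
  exact: (reduces_diff (@reduces_Ftilde_seq n) Fu).
have bF n : (b @: F n <= F n)%VS.
  apply/subvP => _ /memv_imgP[u Fu ->].
  exact: (reduces_diff (reduces_compl (@reduces_Ftilde_seq n)) Fu).
have Fdec n : (F n.+1 <= F n)%VS.
  by rewrite FS; apply: subv_trans (capvSl _ _) _.
pose G X := ((a @: X) :&: (b @: X))%VS.
have [N FN minF] := @stationary_iter _ _ G F FS Fdec.
have -> : Ftilde V W = F N.
  apply/eqP; rewrite eqEsubv; apply/andP; split; apply/subvP => v.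
    by move/memv_seqcapv.
  by move=> vN; apply/memv_seqcapv => n; apply: subvP (minF n) _ vN.
by split; apply/eqP; rewrite eqEsubv ?aF ?bF -{1}FN ?capvSl ?capvSr.
Qed.

(** Together with [limg_Ftilde], this characterizes [Ftilde] as the largest
    subspace mapped onto itself by [a] and by [b]. *)
Lemma sub_Ftilde X : (a @: X = X)%VS -> (b @: X = X)%VS -> (X <= Ftilde V W)%VS.
Proof.
move=> aX bX; apply/subvP => v Xv; apply/memv_seqcapv => n.
apply: subvP v Xv; elim: n => [|n IHn]; first exact: subvf.
rewrite (Ftilde_seqS (@reduces_Ftilde_seq n)) subv_cap.
by rewrite -{1}aX -{2}bX !limgS.
Qed.

Lemma reduces_Ftilde : reduces p q (Ftilde V W).
Proof.
move=> v /memv_seqcapv vF.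
by split; apply/memv_seqcapv => n; have [] := reduces_Ftilde_seq (vF n).
Qed.

End Ftilde.
End Components.

(** * The decomposition of the space and of the lattice elements *)

Section Decomposition.
Set Implicit Arguments.
Unset Strict Implicit.
Variables (K : fieldType) (E : vectType K).
Implicit Types (f r : 'End(E)) (X Y : {vspace E}).

Lemma iter_lfun_mem f X n v :
  (forall u, u \in X -> f u \in X) -> v \in X -> iter n f v \in X.
Proof. by move=> fX Xv; elim: n => //= n; apply: fX. Qed.

Lemma iter_lfun_inj f X n v : (forall u, u \in X -> f u \in X) ->
    (forall u, u \in X -> f u = 0 -> u = 0) ->
  v \in X -> iter n f v = 0 -> v = 0.
Proof.
move=> fX finj; elim: n v => //= n IHn v Xv fv0.
by apply: IHn => //; apply: finj fv0; apply: iter_lfun_mem.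
Qed.

Section Pair.
Variables (p q : 'End(E)) (V W : 'I_2 -> {vspace E}).
Hypotheses (pV : projects p V) (qW : projects q W).
Let a : 'End(E) := p - q.
Let b : 'End(E) := p - (\1%VF - q).

Let qW1 : projects q (fun i => W ((1%g : 'S_2) i)).
Proof. by case: qW => qq Wq0 Wq1; split=> // v; rewrite perm1. Qed.

Let qWtau := projects_compl qW.

Lemma reduces_F1 : reduces p q (F_ V W 1%g).
Proof. exact: (reduces_F pV qW1). Qed.

Lemma reduces_Ftau : reduces p q (F_ V W tau).
Proof. by have /reduces_compl := reduces_F pV qWtau; rewrite subKr. Qed.

Lemma diff_inj_Ftau v : v \in F_ V W tau -> a v = 0 -> v = 0.
Proof.
case/(memv_F _ pV qWtau) => n bv av0.
have bbv : b (b v) = v.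
  by case: pV qW => pp _ _ [qq _ _]; apply: diff_compl_involutive.
have bbkv k : iter (k + k) b v = v.
  by elim: k => // k IHk; rewrite addnS addSn !iterS IHk.
by rewrite -(bbkv n) iterD bv iter_lfun0.
Qed.

(** A power of [a] kills [v0]; a power of [b] then kills what remains of [v1]
    in [F_tau], leaving only an image of [v2] under a map that is injective on
    [Ftilde]. *)
Lemma decomposition_unique v0 v1 v2 :
    v0 \in F_ V W 1%g -> v1 \in F_ V W tau -> v2 \in Ftilde V W ->
  v0 + v1 + v2 = 0 -> [/\ v0 = 0, v1 = 0 & v2 = 0].
Proof.
move=> Fv0 Fv1 Fv2 sum0.
have [aF bF] := limg_Ftilde pV qW.
have a1 := reduces_diff reduces_Ftau.
have a2 := reduces_diff (reduces_Ftilde pV qW).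
have b2 := reduces_diff (reduces_compl (reduces_Ftilde pV qW)).
have [n av0] := (memv_F _ pV qW1).1 Fv0.
have sum12 : iter n a v1 + iter n a v2 = 0.
  by have := iter_lfun0 a n; rewrite -{1}sum0 !iter_lfunD av0 add0r.
have Fav1 : iter n a v1 \in F_ V W tau by apply: iter_lfun_mem Fv1.
have Fav2 : iter n a v2 \in Ftilde V W by apply: iter_lfun_mem Fv2.
have [m bav1] := (memv_F _ pV qWtau).1 Fav1.
have av2 : iter n a v2 = 0.
  apply: (iter_lfun_inj b2 (limg_id_inj bF) Fav2 (n := m)).
  have := iter_lfun0 b m; rewrite -{1}sum12 iter_lfunD.
  by rewrite [X in X + _]bav1 add0r.
have v20 : v2 = 0 by apply: (iter_lfun_inj a2 (limg_id_inj aF) Fv2 av2).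
have av1 : iter n a v1 = 0 by rewrite av2 addr0 in sum12.
have v10 : v1 = 0 by apply: (iter_lfun_inj a1 diff_inj_Ftau Fv1 av1).
by split=> //; rewrite v10 v20 !addr0 in sum0.
Qed.

Lemma decomposition_exists v : exists v0 v1 v2,
  [/\ v0 \in F_ V W 1%g, v1 \in F_ V W tau, v2 \in Ftilde V W
    & v = v0 + v1 + v2].
Proof.
have iter_red f X n : (forall Y, reduces p q Y -> reduces p q (f @: Y)) ->
    reduces p q X -> reduces p q (iter n (fun Y => f @: Y)%VS X).
  by move=> fred redX; elim: n => //= n; apply: fred.
have redE : reduces p q fullv by move=> u _; rewrite !memvf.
(* [I] is the summand of [E] on which [a] is bijective, and [J] the summand of
   [I] on which [b] is bijective too. *)
have [N] := fitting (subvf (a @: fullv)).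
set I := iter N _ _ => /= aI splitI.
have redI : reduces p q I.
  by apply: iter_red => // Y; apply: (reduces_limg pV qW).
have bI : (b @: I <= I)%VS.
  apply/subvP => _ /memv_imgP[u Iu ->].
  exact: (reduces_diff (reduces_compl redI) Iu).
have [M] := fitting bI.
set J := iter M _ _ => /= bJ splitJ.
have redJ : reduces p q J.
  by apply: iter_red => // Y; apply: (reduces_limg_compl pV qW).
have subJI : (J <= I)%VS.
  by rewrite /J; elim: M {splitJ bJ redJ J} => //= M IHM;
    apply: subv_trans (limgS _ IHM) bI.
(* Surjectivity of [a] on [I] makes it injective there, hence on [J], and so
   surjective on [J]. *)
have aJ : (a @: J)%VS = J.
  apply: inj_limg_id => [|u Ju].
    by apply/subvP => _ /memv_imgP[u Ju ->]; apply: (reduces_diff redJ Ju).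
  exact: limg_id_inj aI u (subvP subJI _ Ju).
have [w Iw avw] := splitI v (memvf v).
have [z Jz bwz] := splitJ w Iw.
exists (v - w), (w - z), z; split.
- by apply/(memv_F _ pV qW1); exists N.
- by apply/(memv_F _ pV qWtau); exists M.
- by apply: subvP Jz; apply: sub_Ftilde aJ bJ.
- by rewrite addrA subrK subrK.
Qed.

(** Equivalent to [X] being the sum of its intersections with the three
    components, in a form that is visibly inherited by sums and
    intersections. *)
Definition splits X := forall v0 v1 v2,
  v0 \in F_ V W 1%g -> v1 \in F_ V W tau -> v2 \in Ftilde V W ->
  v0 + v1 + v2 \in X -> [/\ v0 \in X, v1 \in X & v2 \in X].

Lemma splits_cap X Y : splits X -> splits Y -> splits (X :&: Y).
Proof.
move=> sX sY v0 v1 v2 F0 F1 F2; rewrite !memv_cap => /andP[Xv Yv].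
have [-> -> ->] := sX _ _ _ F0 F1 F2 Xv.
by have [-> -> ->] := sY _ _ _ F0 F1 F2 Yv.
Qed.

Lemma splits_add X Y : splits X -> splits Y -> splits (X + Y).
Proof.
move=> sX sY v0 v1 v2 F0 F1 F2 /memv_addP[x Xx [y Yy vxy]].
have [x0 [x1 [x2 [Fx0 Fx1 Fx2 xE]]]] := decomposition_exists x.
have [y0 [y1 [y2 [Fy0 Fy1 Fy2 yE]]]] := decomposition_exists y.
have [Xx0 Xx1 Xx2] : [/\ x0 \in X, x1 \in X & x2 \in X].
  by apply: sX; rewrite // -xE.
have [Yy0 Yy1 Yy2] : [/\ y0 \in Y, y1 \in Y & y2 \in Y].
  by apply: sY; rewrite // -yE.
have [||||e0 e1 e2] := @decomposition_unique
    (v0 - (x0 + y0)) (v1 - (x1 + y1)) (v2 - (x2 + y2)).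
- by rewrite rpredB ?rpredD.
- by rewrite rpredB ?rpredD.
- by rewrite rpredB ?rpredD.
- rewrite (addrACA v0) -opprD (addrACA (v0 + v1)) -opprD vxy xE yE.
  by rewrite (addrACA x0) (addrACA (x0 + x1)) subrr.
by rewrite (subr0_eq e0) (subr0_eq e1) (subr0_eq e2); split; apply: memv_add.
Qed.

(** An endomorphism preserving each component kills a sum of components only
    if it kills each of them. *)
Lemma splits_ker r X : (forall v, (v \in X) = (r v == 0)) ->
    (forall Y v, reduces p q Y -> v \in Y -> r v \in Y) -> splits X.
Proof.
move=> Xr redr v0 v1 v2 F0 F1 F2; rewrite !Xr !linearD /= => /eqP sum0.
have [| | | -> -> ->] := decomposition_unique _ _ _ sum0.
- exact: redr reduces_F1 F0.
- exact: redr reduces_Ftau F1.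
- exact: redr (reduces_Ftilde pV qW) F2.
by rewrite eqxx.
Qed.

(** The two summands of a decomposition are the kernels of [1 - r] and [r],
    where [r] is the corresponding projection. *)
Lemma splits_summand r U i : projects r U ->
  (forall Y v, reduces p q Y -> v \in Y -> r v \in Y) -> splits (U i).
Proof.
move=> rU redr; move: i; apply: ord2P; last first.
  by have [_ _ U1] := rU; apply: splits_ker U1 redr.
have [_ _ /= U0] := projects_compl rU.
apply: (@splits_ker (\1%VF - r)) => [v|Y v redY Yv].
  by rewrite -U0 tpermR.
by rewrite subr_lfunE id_lfunE rpredB ?(redr Y).
Qed.

Lemma splits_lattice X : lattice_generated (range V `|` range W) X -> splits X.
Proof.
elim=> [_ [] [i _ <-]|Y Z _ sY _ sZ|Y Z _ sY _ sZ].
- by apply: splits_summand pV _ => Y v redY /redY[].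
- by apply: splits_summand qW _ => Y v redY /redY[].
- exact: splits_add.
- exact: splits_cap.
Qed.

Lemma splits_direct X : splits X ->
  X = ((X :&: F_ V W 1%g) + (X :&: F_ V W tau) + (X :&: Ftilde V W))%VS /\
  directv ((X :&: F_ V W 1%g) + (X :&: F_ V W tau) + (X :&: Ftilde V W)).
Proof.
move=> sX; split.
  apply/eqP; rewrite eqEsubv !subv_add !capvSl !andbT; apply/subvP => v Xv.
  have [v0 [v1 [v2 [F0 F1 F2 vE]]]] := decomposition_exists v.
  have [|X0 X1 X2] := sX _ _ _ F0 F1 F2; first by rewrite -vE.
  by rewrite vE !memv_add // memv_cap ?X0 ?X1 ?X2.
have subF Y v : v \in (X :&: Y)%VS -> v \in Y by rewrite memv_cap => /andP[].
rewrite directv_addE /=; apply/and3P; split; last 1 first.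
- rewrite -subv0; apply/subvP => v /[!memv_cap] /andP[].
  case/memv_addP => v0 /subF F0 [v1 /subF F1 ->] /andP[_ F2].
  have NF2 : - (v0 + v1) \in Ftilde V W by rewrite rpredN.
  have [-> -> _] := decomposition_unique F0 F1 NF2 (subrr _).
  by rewrite addr0 mem0v.
- apply/directv_addP/eqP; rewrite -subv0; apply/subvP => v.
  rewrite memv_cap => /andP[/subF F0 /subF F1].
  have NF1 : - v \in F_ V W tau by rewrite rpredN.
  have [|-> _ _] := decomposition_unique F0 NF1 (mem0v _); last exact: mem0v.
  by rewrite subrr addr0.
- by rewrite directvE /=.
Qed.

End Pair.
End Decomposition.

Theorem proposition22 (K : fieldType) (char_neq2 : 2%N \notin [pchar K])
    (E : vectType K) (V W : 'I_2 -> {vspace E})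
    (sumV : (V ord0 + V ord_max)%VS = fullv)
    (directV : directv (V ord0 + V ord_max))
    (sumW : (W ord0 + W ord_max)%VS = fullv)
    (directW : directv (W ord0 + W ord_max))
    (X : {vspace E})
    (latX : lattice_generated (range V `|` range W) X) :
  X = ((X :&: F_ V W 1%g) + (X :&: F_ V W tau) + (X :&: Ftilde V W))%VS /\
  directv ((X :&: F_ V W 1%g) + (X :&: F_ V W tau) + (X :&: Ftilde V W)).
Proof.
have pV := projects_daddv_pi sumV directV.
have qW := projects_daddv_pi sumW directW.
exact: (splits_direct pV qW (splits_lattice pV qW latX)).
Qed.
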